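(* Let $(A_n)_{n\in\mathbb N}$ be a sequence of (deterministic) symmetric $n\times n$ matrices with nonnegative entries such that $A_n^TA_n$ is irreducible for all $n\in\mathbb N$. Assume that there exist $(\varepsilon_n)_{n\in\mathbb N}\subset(0,\infty)$ with $\varepsilon_n\to0$ and $(\mu_n)_{n\in\mathbb N}\subset(0,1)$ such that $(A_n)_{n\in\mathbb N}$ is $(\varepsilon_n,\mu_n)_{n\in\mathbb N}$ almost regular. For each $n$, let $v_n:=\mathop{\mathrm{arg\,max}}_{x\in\mathbb R^n:\|x\|_r\le1}\|A_nx\|_p$ (the maximizer with nonnegative entries). Then there exists $n_0\ge1$ such that the following hold. (a) For $1<p<r<\infty$ and all $n\ge n_0$, $$\|v_n-n^{-1/r}\mathbf 1\|_\infty\le\frac{2p}{r-p}\,n^{-\frac1r}\big(\varepsilon_n+O(\varepsilon_n^2)\big).$$ (b) For $p=r\in(1,\infty)$, assume further that $(A_n)_{n\in\mathbb N}$ is $(C^*,\mu_n)_{n\in\mathbb N}$ well-connected for some constant $C^*>0$. Then for all $n\ge n_0$, $$\|v_n-n^{-1/r}\mathbf 1\|_\infty\le\frac{10r}{C^*(r-1)}\,\varepsilon_n\,n^{-\frac1r}.$$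
   Context: $\|x\|_q=(\sum_i|x_i|^q)^{1/q}$, $\|x\|_\infty=\max_i|x_i|$, and $\mathbf 1\in\mathbb R^n$ is the all-ones vector. $O(\varepsilon_n^2)$ denotes a sequence bounded in absolute value by a constant (independent of $n$) times $\varepsilon_n^2$. For a nonnegative matrix $A_n=(a^n_{ij})$ put $d_n(i)=\sum_{j\in[n]}a^n_{ij}$, $[n]=\{1,\dots,n\}$. Almost regular: $(A_n)_{n\in\mathbb N}$ is $(\varepsilon_n,\mu_n)_{n\in\mathbb N}$ almost regular if there exists $n_0\ge1$ such that for all $n\ge n_0$, $\max_{i\in[n]}|d_n(i)-n\mu_n|\le n\mu_n\varepsilon_n$. Well-connected: for a constant $C^*\in(0,\infty)$, $(A_n)_{n\in\mathbb N}$ is $(C^*,\mu_n)_{n\in\mathbb N}$ well-connected if there exists $n_0\ge1$ such that for all $n\ge n_0$ and all $i,j\in[n]$, $\sum_{k\in[n]}a^n_{ik}a^n_{kj}\ge C^*n\mu_n^2$. *)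

(* Defs.v *)
From HB Require Import structures.
From mathcomp Require Import all_boot all_order all_algebra.
From mathcomp Require Import all_classical all_reals all_analysis.

Set Implicit Arguments.
Unset Strict Implicit.
Unset Printing Implicit Defensive.

Import Order.TTheory GRing.Theory Num.Theory.
Import numFieldNormedType.Exports.

Local Open Scope classical_set_scope.
Local Open Scope ring_scope.

(* The l^q norm for real q. The l^oo norm is the library norm `|x| of a
   matrix, which is the maximum of the absolute values of the entries. *)
Definition lnorm (R : realType) (n : nat) (q : R) (x : 'cV[R]_n) : R :=
  (\sum_(i < n) `|x i 0| `^ q) `^ q^-1.

(* Irreducibility in the sense of Perron-Frobenius theory; it is meant for
   matrices with nonnegative entries only. *)
Definition irreducible_mx (R : realType) (n : nat) (M : 'M[R]_n) : Prop :=
  forall i j : 'I_n, exists k : nat, (0 < k)%N /\ 0 < (M ^+ k) i j.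

Definition is_argmax_rp (R : realType) (n : nat) (r p : R) (A : 'M[R]_n)
    (v : 'cV[R]_n) : Prop :=
  lnorm r v <= 1 /\
  forall x : 'cV[R]_n, lnorm r x <= 1 -> lnorm p (A *m x) <= lnorm p (A *m v).

Definition row_sum (R : realType) (n : nat) (A : 'M[R]_n) (i : 'I_n) : R :=
  \sum_(j < n) A i j.

(* Sequences indexed by the positive integers are functions on nat whose value
   at 0 is irrelevant. *)
Definition almost_regular (R : realType) (eps mu : nat -> R)
    (A : forall n : nat, 'M[R]_n) : Prop :=
  exists n0 : nat, (1 <= n0)%N /\
    forall n : nat, (n0 <= n)%N ->
      \big[Num.max/0]_(i < n) `|row_sum (A n) i - n%:R * mu n|
        <= n%:R * mu n * eps n.

Definition well_connected (R : realType) (Cs : R) (mu : nat -> R)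
    (A : forall n : nat, 'M[R]_n) : Prop :=
  exists n0 : nat, (1 <= n0)%N /\
    forall n : nat, (n0 <= n)%N -> forall i j : 'I_n,
      Cs * n%:R * mu n ^+ 2 <= \sum_(k < n) A n i k * A n k j.

(* Main.v *)
Require Import Defs.
From HB Require Import structures.
From mathcomp Require Import all_boot all_order all_algebra.
From mathcomp Require Import all_classical all_reals all_analysis.
From mathcomp Require Import ring lra.

Set Implicit Arguments.
Unset Strict Implicit.
Unset Printing Implicit Defensive.

Import Order.TTheory GRing.Theory Num.Theory.
Import numFieldNormedType.Exports.
Local Open Scope classical_set_scope.
Local Open Scope ring_scope.

(** Let [M] and [m] be the largest and the smallest entry of the maximizer [v].
    A vector of unit [r]-norm has [m <= n^(-1/r) <= M], so it is enough to bound
    [M - m] by a multiple of [m].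

    The maximizer satisfies the critical equation
    [g v^(r-1) = A (A v)^(p-1)] (entrywise powers) with some [g > 0]
    ([argmax_critical]), and irreducibility makes it positive ([argmax_pos]).
    Almost regularity says that the row sums of [A] lie between [D (1 - e)] and
    [D (1 + e)], with [D = n mu] and [e = eps n].

    For [p < r], the equation at the maximum gives
    [g M^(r-p) <= (D (1 + e))^p], and at the minimum
    [g m^(r-p) >= (D (1 - e))^p]. Hence
    [M / m <= ((1 + e) / (1 - e))^(p/(r-p))], whose expansion is
    [1 + 2 p / (r - p) e + O(e^2)] ([critical_ratio_le], [powR_ratio_le]).

    For [p = r] these inequalities only locate [g] between [(D (1 - e))^r] and
    [(D (1 + e))^r], an interval of relative width about [2 r e]. The
    information on [M / m] comes from well-connectedness: two steps along [A]
    average [v] with at least a share [Cs] of the uniform weight, so the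
    equation at the maximum loses an amount of relative size
    [(r - 1) Cs (M - a) / M], where [a] is the mean of [v], and this loss cannot
    exceed the width of the interval. The same holds at the minimum, so that
    [M - m] is at most about [4 r / (Cs (r - 1)) e M] ([critical_gap_defect],
    [critical_osc_le]); the constant 10 leaves room for the lower-order
    terms. *)

(** * Weighted means and real powers *)

(** The weighted arithmetic-geometric inequality, which is Young's inequality
    in the variables [c `^ (1 - th)] and [a `^ th]. The tangent inequalities for
    powers and both uses of Hoelder's inequality rest on it. *)
Lemma wamgm (R : realType) (c a th : R) : 0 <= c -> 0 <= a -> 0 <= th <= 1 ->
  c `^ (1 - th) * a `^ th <= (1 - th) * c + th * a.
Proof.
move=> c0 a0 /andP[].
rewrite le_eqVlt => /orP[/eqP <-|th0].
  by rewrite subr0 powRr1// powRr0 mul0r addr0 mulr1 mul1r.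
rewrite le_eqVlt => /orP[/eqP ->|th1].
  by rewrite subrr powRr1// powRr0 mul0r add0r mul1r.
have th1' : 0 < 1 - th by rewrite subr_gt0.
have := @conjugate_powR R (c `^ (1 - th)) (a `^ th) (1 - th)^-1 th^-1
  (powR_ge0 _ _) (powR_ge0 _ _).
rewrite !invr_gt0 !invrK -!powRrM !divff ?gt_eqF// !powRr1// subrK.
by move=> /(_ th1' th0 erefl); rewrite (mulrC c) (mulrC a).
Qed.

(** The equality case comes from the inequality itself, applied to the square
    roots [x] of [c] and [y] of [a]: squaring it bounds the geometric mean of
    [c] and [a] by [((1 - th) * x + th * y) ^+ 2], which falls short of their
    arithmetic mean by exactly [th * (1 - th) * (x - y) ^+ 2]. *)
Lemma wamgm_eq (R : realType) (c a th : R) : 0 <= c -> 0 <= a -> 0 < th < 1 ->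
  (1 - th) * c + th * a <= c `^ (1 - th) * a `^ th -> a = c.
Proof.
move=> c0 a0 /andP[th0 th1].
have sq (z : R) : 0 <= z -> z = (z `^ 2^-1) ^+ 2.
  by move=> z0; rewrite -powR_mulrn ?powR_ge0// -powRrM mulVf// powRr1.
have H := @wamgm R (c `^ 2^-1) (a `^ 2^-1) th (powR_ge0 _ _) (powR_ge0 _ _) _.
have {H} := H (introT andP (conj (ltW th0) (ltW th1))).
have -> : c `^ (1 - th) * a `^ th =
    ((c `^ 2^-1) `^ (1 - th) * (a `^ 2^-1) `^ th) ^+ 2.
  rewrite exprMn (powRAC c 2^-1 (1 - th)) (powRAC a 2^-1 th).
  congr (_ * _); apply: sq; exact: powR_ge0.
have x0 : 0 <= c `^ 2^-1 by exact: powR_ge0.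
have y0 : 0 <= a `^ 2^-1 by exact: powR_ge0.
rewrite {3}(sq c)// {3}(sq a)//.
have w0 : 0 <= (c `^ 2^-1) `^ (1 - th) * (a `^ 2^-1) `^ th.
  by rewrite mulr_ge0 ?powR_ge0.
move: (_ * _ `^ th) w0 => w w0 wle le_w.
suff xy : c `^ 2^-1 = a `^ 2^-1 by rewrite (sq c)// (sq a)// xy.
move: (c `^ _) (a `^ _) x0 y0 wle le_w => x y x0 y0 wle le_w.
have {le_w} le_w : th * (1 - th) * (x - y) ^+ 2 <= 0.
  have : w ^+ 2 <= ((1 - th) * x + th * y) ^+ 2.
    by rewrite ler_sqr ?nnegrE// (le_trans w0).
  nra.
have t1 : 0 < th * (1 - th) by rewrite mulr_gt0// subr_gt0.
move: le_w; rewrite pmulr_rle0// => le_w.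
by apply/eqP; rewrite -subr_eq0 -sqrf_eq0 eq_le le_w sqr_ge0.
Qed.

(** Bernoulli's inequality in homogeneous form, obtained without derivatives
    from [wamgm] with weight [b^-1] on [y `^ b]. *)
Lemma powR_ge_tangent (R : realType) (b x y : R) : 1 <= b -> 0 <= x -> 0 <= y ->
  b * x `^ (b - 1) * (y - x) <= y `^ b - x `^ b.
Proof.
move=> b1 x0 y0; have b0 : 0 < b by rewrite (lt_le_trans ltr01).
have := @wamgm R (x `^ b) (y `^ b) b^-1 (powR_ge0 _ _) (powR_ge0 _ _).
rewrite invr_ge0 invf_le1// b1 (ltW b0) => /(_ isT).
rewrite -!powRrM mulrBr mulr1 divff ?gt_eqF// (powRr1 y0) => H.
have := ler_wpM2l (ltW b0) H.
rewrite mulrDr !mulrA mulrBr divff ?gt_eqF// mulr1 mul1r -(mulr_powRB1 x0 b0).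
by move: (x `^ _) (y `^ _) => X Y; nra.
Qed.

Lemma powR_le_tangent (R : realType) (b x y : R) :
  0 <= b <= 1 -> 0 < x -> 0 <= y ->
  y `^ b - x `^ b <= b * x `^ (b - 1) * (y - x).
Proof.
move=> b01 x0 y0.
have H := wamgm (ltW x0) y0 b01.
have xb : x `^ (b - 1) * x `^ (1 - b) = 1.
  by rewrite -powRD ?(gt_eqF x0) ?implybT// -opprB addNr powRr0.
have xb1 : x `^ (b - 1) * x = x `^ b.
  by rewrite -[X in _ * X](powRr1 (ltW x0)) -powRD ?(gt_eqF x0) ?implybT// subrK.
have := ler_wpM2l (powR_ge0 x (b - 1)) H.
rewrite mulrA xb mul1r mulrDr -xb1; move: (x `^ _) (y `^ _) => X Y; nra.
Qed.

Lemma powR_le_npow (R : realType) (b x y : R) : b <= 0 -> 0 < x -> x <= y ->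
  y `^ b <= x `^ b.
Proof.
move=> b0 x0 xy; rewrite -(opprK b) !(powRN _ (- b)).
rewrite lef_pV2 ?posrE ?powR_gt0 ?(lt_le_trans x0)//.
apply: ge0_ler_powR => //; rewrite ?nnegrE ?oppr_ge0 ?(ltW x0)//.
by rewrite (le_trans (ltW x0)).
Qed.

(** The slope of a chord of [t `^ b] inside [[Y, X]] is at least the smaller of
    the two end slopes. As the derivative is monotone, which of the two ends is
    the smaller depends on whether [b] exceeds 1; asking [k] to be below both
    covers the two cases at once. *)
Lemma powR_secant_ge (R : realType) (b k Y s t X : R) : 0 < b -> 0 < Y ->
  k <= Y `^ (b - 1) -> k <= X `^ (b - 1) -> Y <= s -> s <= t -> t <= X ->
  b * k * (t - s) <= t `^ b - s `^ b.
Proof.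
move=> b0 Y0 kY kX Ys st tX.
have s0 := lt_le_trans Y0 Ys; have t0 := lt_le_trans s0 st.
have [b1|b1] := leP 1 b.
- apply: le_trans (powR_ge_tangent b1 (ltW s0) (ltW t0)).
  rewrite ler_wpM2r ?subr_ge0// ler_wpM2l ?(ltW b0)//.
  apply: le_trans kY _; apply: ge0_ler_powR; rewrite ?nnegrE ?subr_ge0 ?(ltW s0) ?(ltW Y0)//.
- have := @powR_le_tangent R b t s; rewrite (ltW b0) (ltW b1) => /(_ isT t0 (ltW s0)).
  have : b * k * (t - s) <= b * t `^ (b - 1) * (t - s).
    rewrite ler_wpM2r ?subr_ge0// ler_wpM2l ?(ltW b0)//.
    by apply: le_trans kX _; apply: powR_le_npow; rewrite ?subr_le0 ?(ltW b1).
  by move: (t `^ _) (s `^ _) (t `^ _) => T S U; nra.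
Qed.

(** Since [1 + y <= expR y], the power is at most [expR z] with [z := q * y],
    which is at most [(1 - z)^-1] and hence at most [1 + z + 2 * z ^+ 2] for
    [z <= 1/2]. *)
Lemma powR1D_le (R : realType) (q y : R) : 0 <= q -> 0 <= y -> q * y <= 2^-1 ->
  (1 + y) `^ q <= 1 + q * y + 2 * (q * y) ^+ 2.
Proof.
move=> q0 y0 qy.
have z0 : 0 <= q * y by rewrite mulr_ge0.
apply: (@le_trans _ _ (expR (q * y))).
  rewrite -[leLHS]lnK ?posrE ?powR_gt0 ?ltr_pwDl// ler_expR ln_powR.
  by rewrite ler_wpM2l// le_ln1Dx// (lt_le_trans _ y0)// ltrN10.
move: (q * y) z0 qy => z z0 z1.
have := expR_ge1Dx (- z); rewrite expRN => H.
have e0 := expR_gt0 z.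
have : (1 - z) * expR z <= 1.
  by rewrite -ler_pdivlMr// div1r.
move: (expR z) e0 {H} => E e0; nra.
Qed.

(** * The critical equation of the maximizer *)

Lemma powR_inv_le (R : realType) (r x y : R) : 0 < r -> 0 <= x -> 0 <= y ->
  (x `^ r^-1 <= y `^ r^-1) = (x <= y).
Proof.
move=> r0 x0 y0; have ri : 0 < r^-1 by rewrite invr_gt0.
apply/idP/idP; last by move=> xy; apply: ge0_ler_powR; rewrite ?nnegrE ?(ltW ri).
apply: contra_le => yx; apply: gt0_ltr_powR; rewrite ?nnegrE//.
Qed.

Lemma powR_VK (R : realType) (r x : R) : 0 < r -> 0 <= x ->
  (x `^ r^-1) `^ r = x.
Proof. by move=> r0 x0; rewrite -powRrM mulVf ?gt_eqF// powRr1. Qed.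

Lemma powR_KV (R : realType) (r x : R) : 0 < r -> 0 <= x ->
  (x `^ r) `^ r^-1 = x.
Proof. by move=> r0 x0; rewrite -powRrM mulfV ?gt_eqF// powRr1. Qed.

(** For nonnegative data, outer powers and absolute values can be dropped, so
    that maximality becomes a comparison of plain power sums. *)
Lemma is_argmax_rp_sum (R : realType) (n : nat) (r p : R) (A : 'M[R]_n)
    (v : 'cV[R]_n) : 0 < r -> 0 < p ->
  (forall i j, 0 <= A i j) -> (forall i, 0 <= v i 0) -> is_argmax_rp r p A v ->
  \sum_i v i 0 `^ r <= 1 /\
  forall x : 'cV[R]_n, (forall i, 0 <= x i 0) -> \sum_i x i 0 `^ r <= 1 ->
    \sum_k (A *m x) k 0 `^ p <= \sum_k (A *m v) k 0 `^ p.
Proof.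
move=> r0 p0 A0 v0 [vle vmax].
have nE q (x : 'cV[R]_n) : (forall i, 0 <= x i 0) ->
    lnorm q x = (\sum_i x i 0 `^ q) `^ q^-1.
  by move=> x0; rewrite /lnorm; under eq_bigr => i _ do rewrite ger0_norm//.
have s0 q (x : 'cV[R]_n) : 0 <= \sum_i x i 0 `^ q.
  by apply: sumr_ge0 => i _; exact: powR_ge0.
have Ax0 (x : 'cV[R]_n) : (forall i, 0 <= x i 0) -> forall k, 0 <= (A *m x) k 0.
  by move=> x0 k; rewrite mxE; apply: sumr_ge0 => j _; rewrite mulr_ge0.
have le1 (x : 'cV[R]_n) : (forall i, 0 <= x i 0) ->
    (lnorm r x <= 1) = (\sum_i x i 0 `^ r <= 1).
  have e1 : (1 : R) `^ r^-1 = 1 by rewrite powR1.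
  by move=> x0; rewrite nE// -[X in _ <= X]e1 powR_inv_le.
split; first by rewrite -le1.
move=> x x0; rewrite -le1// => /vmax.
by rewrite !nE ?powR_inv_le//; exact: Ax0.
Qed.

(** The Euler-Lagrange equation of the maximizer, by duality instead of
    differentiation. Write [u] for [A *m v] and [z] for the transposed matrix
    applied to [u `^ (p - 1)]. By Hoelder and maximality, [v] also maximizes
    the linear form [x |-> \sum_i z i * x i 0] over the nonnegative part of the
    unit ball. The maximizer of a linear form is explicit, so [v] attains
    equality in Hoelder's inequality, and the equality case of [wamgm] forces
    [v `^ r] to be proportional to [z `^ (r / (r - 1))]. *)
Lemma argmax_critical (R : realType) (n : nat) (r p : R) (A : 'M[R]_n)
    (v : 'cV[R]_n) : 1 < r -> 1 < p ->
  (forall i j, 0 <= A i j) -> (forall i, 0 <= v i 0) -> is_argmax_rp r p A v ->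
  A *m v != 0 ->
  \sum_i v i 0 `^ r = 1 /\
  exists2 g : R, 0 < g & forall i,
    g * v i 0 `^ (r - 1) = \sum_k A k i * (A *m v) k 0 `^ (p - 1).
Proof.
move=> r1 p1 A0 v0 hv Av0.
have r0 : 0 < r := lt_trans ltr01 r1; have p0 : 0 < p := lt_trans ltr01 p1.
have [vle vmax] := is_argmax_rp_sum r0 p0 A0 v0 hv.
have Ax0 (x : 'cV[R]_n) : (forall i, 0 <= x i 0) -> forall k, 0 <= (A *m x) k 0.
  by move=> x0 k; rewrite mxE; apply: sumr_ge0 => j _; rewrite mulr_ge0.
pose u k := (A *m v) k 0.
have u0 k : 0 <= u k by exact: Ax0.
pose z i := \sum_k A k i * u k `^ (p - 1).
have z0 i : 0 <= z i by apply: sumr_ge0 => k _; rewrite mulr_ge0 ?powR_ge0.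
have zE (x : 'cV[R]_n) :
    \sum_i z i * x i 0 = \sum_k u k `^ (p - 1) * (A *m x) k 0.
  under eq_bigr do rewrite mulr_suml.
  rewrite exchange_big /=; apply: eq_bigr => k _.
  by rewrite mxE mulr_sumr; apply: eq_bigr => i _; ring.
have zv : \sum_i z i * v i 0 = \sum_k u k `^ p.
  by rewrite zE; apply: eq_bigr => k _; rewrite -/(u k) mulrC mulr_powRB1.
have pi01 : 0 <= p^-1 <= 1 by rewrite invr_ge0 invf_le1// !ltW.
(* Hoelder's inequality against x, applied termwise as wamgm with weight
   p^-1 on the entries of A *m x *)
have zmax (x : 'cV[R]_n) : (forall i, 0 <= x i 0) -> \sum_i x i 0 `^ r <= 1 ->
    \sum_i z i * x i 0 <= \sum_i z i * v i 0.
  move=> x0 /(vmax _ x0) xle; rewrite zv zE.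
  apply: (@le_trans _ _
    (\sum_k ((1 - p^-1) * u k `^ p + p^-1 * (A *m x) k 0 `^ p))).
    apply: ler_sum => k _.
    have := wamgm (powR_ge0 (u k) p) (powR_ge0 ((A *m x) k 0) p) pi01.
    by rewrite powR_KV ?Ax0// -powRrM mulrBr mulr1 divff ?gt_eqF.
  rewrite big_split /= -!mulr_sumr.
  have : p^-1 * \sum_k (A *m x) k 0 `^ p <= p^-1 * \sum_k u k `^ p.
    by rewrite ler_wpM2l// invr_ge0 ltW.
  by rewrite mulrBl mul1r; lra.
pose th := r^-1.
have th01 : 0 < th < 1 by rewrite invr_gt0 r0 invf_lt1.
have th1 : 0 < 1 - th by rewrite subr_gt0; case/andP: th01.
pose Z := \sum_i z i `^ (1 - th)^-1.
have Z0 : 0 < Z.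
  have sum_gt0 (f : 'I_n -> R) i0 : (forall i, 0 <= f i) -> 0 < f i0 ->
      0 < \sum_i f i.
    move=> f0 fi; rewrite (bigD1 i0)//= ltr_pwDl//.
    by apply: sumr_ge0.
  have [k0 uk0] : exists k, 0 < u k.
    apply/existsP; apply: contraNT Av0; rewrite negb_exists => /forallP H.
    apply/eqP/matrixP => k j; rewrite ord1 [RHS]mxE.
    by apply/eqP; rewrite eq_le (Ax0 v)// andbT leNgt; exact: H.
  have : 0 < \sum_i z i * v i 0.
    by rewrite zv; apply: (sum_gt0 _ k0) => [k|]; rewrite ?powR_ge0 ?powR_gt0.
  move=> /gt_eqF/eqP/psumr_neq0P[i _|i /=]; first by rewrite mulr_ge0.
  move=> zvi; apply: (sum_gt0 _ i) => [k|]; first exact: powR_ge0.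
  rewrite powR_gt0// lt_def z0 andbT; apply: contraTN zvi => /eqP ->.
  by rewrite mul0r ltxx.
(* the r-th powers of the entries of the maximizer of the linear form *)
pose c i := z i `^ (1 - th)^-1 / Z.
have c0 i : 0 <= c i by rewrite divr_ge0 ?powR_ge0 ?(ltW Z0).
have sc : \sum_i c i = 1 by rewrite -mulr_suml divff ?gt_eqF.
have zc i : z i = Z `^ (1 - th) * c i `^ (1 - th).
  rewrite -powRM ?(ltW Z0)// mulrC divfK ?gt_eqF//.
  by rewrite powR_VK.
have g0 : 0 < Z `^ (1 - th) by rewrite powR_gt0.
pose a i := v i 0 `^ r.
have a0 i : 0 <= a i by exact: powR_ge0.
have opt : 1 <= \sum_i c i `^ (1 - th) * a i `^ th.
  have := zmax (\col_i c i `^ th).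
  rewrite (_ : \sum_i z i * (\col_i0 c i0 `^ th) i 0 = Z `^ (1 - th)); last first.
    rewrite -[RHS]mulr1 -[X in _ = _ * X]sc mulr_sumr; apply: eq_bigr => i _.
    by rewrite mxE zc -mulrA -powRD subrK ?oner_eq0// powRr1.
  rewrite (_ : \sum_i z i * v i 0 =
      Z `^ (1 - th) * \sum_i c i `^ (1 - th) * a i `^ th); last first.
    by rewrite mulr_sumr; apply: eq_bigr => i _; rewrite zc powR_KV// mulrA.
  move=> le_g; rewrite -(ler_pM2l g0) mulr1; apply: le_g.
    by move=> i; rewrite mxE powR_ge0.
  by rewrite -[X in _ <= X]sc; apply: ler_sum => i _; rewrite mxE powR_VK.
(* optimality makes these nonnegative defects sum to zero *)
pose d i := (1 - th) * c i + th * a i - c i `^ (1 - th) * a i `^ th.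
have th01' : 0 <= th <= 1 by case/andP: th01 => *; rewrite !ltW.
have d0 i : 0 <= d i by rewrite subr_ge0 wamgm.
have sd : \sum_i d i = 0.
  apply/eqP; rewrite eq_le; apply/andP; split; last exact: sumr_ge0.
  rewrite sumrB big_split /= -!mulr_sumr sc.
  have : th * \sum_i a i <= th * 1 by rewrite ler_wpM2l//; case/andP: th01'.
  by move: opt; lra.
have ac i : a i = c i.
  apply: (wamgm_eq (c0 i) (a0 i) th01); rewrite -subr_le0.
  by rewrite -/(d i) (psumr_eq0P _ sd).
split; first by rewrite -[RHS]sc; apply: eq_bigr => i _; exact: ac.
exists (Z `^ (1 - th)) => // i.
rewrite -/(z i) zc -ac; congr (_ * _).
by rewrite -powRrM mulrBr mulr1 divff ?gt_eqF.
Qed.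

(** A set of indices that is stable under the edges of an irreducible
    nonnegative matrix is stable under its walks, hence empty or everything. *)
Lemma irreducible_closed (R : realType) (n : nat) (M : 'M[R]_n)
    (S : 'I_n -> Prop) : (forall i j, 0 <= M i j) -> irreducible_mx M ->
  (forall i j, 0 < M i j -> S j -> S i) -> (exists j, S j) -> forall i, S i.
Proof.
move=> M0 irr step [j Sj] i.
have Mk0 k i' j' : 0 <= (M ^+ k) i' j'.
  elim: k i' => [|k IH] i'; first by rewrite expr0 mxE; case: eqP.
  by rewrite exprS mxE; apply: sumr_ge0 => l _; rewrite mulr_ge0.
have [k [_]] := irr i j.
elim: k i => [|k IH] i.
  by rewrite expr0 mxE; case: eqP => [->|]; rewrite ?ltxx.
rewrite exprS mxE => /gt_eqF/eqP/psumr_neq0P[l _|l /= Ml].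
  by rewrite mulr_ge0.
have Mil : M i l != 0 by apply: contraTneq Ml => ->; rewrite mul0r ltxx.
have Mlj : (M ^+ k) l j != 0 by apply: contraTneq Ml => ->; rewrite mulr0 ltxx.
by apply: (step _ l); [|apply: IH]; rewrite lt_def ?Mil ?Mlj ?M0 ?Mk0.
Qed.

(** The critical equation propagates positivity: if [v j 0] is positive and
    some row [k] has positive entries in the columns [i] and [j], then
    [(A *m v) k 0] is positive, and so is the right-hand side of the equation
    at [i]. Irreducibility of [A^T *m A] spreads this to all indices. *)
Lemma argmax_pos (R : realType) (n : nat) (r p : R) (A : 'M[R]_n)
    (v : 'cV[R]_n) : 1 < r -> 1 < p ->
  (forall i j, 0 <= A i j) -> irreducible_mx (A^T *m A) ->
  (forall i, 0 <= v i 0) -> is_argmax_rp r p A v ->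
  A *m v != 0 -> forall i, 0 < v i 0.
Proof.
move=> r1 p1 A0 irr v0 hv Av0.
have [sv [g g0 hg]] := argmax_critical r1 p1 A0 v0 hv Av0.
apply: (irreducible_closed _ irr).
- by move=> i j; rewrite mxE; apply: sumr_ge0 => k _; rewrite mxE mulr_ge0.
- move=> i j; rewrite mxE => /gt_eqF/eqP/psumr_neq0P[k _|k /= ].
    by rewrite mxE mulr_ge0.
  rewrite mxE => Akk vj.
  have Aki : 0 < A k i.
    by rewrite lt_def A0 andbT; apply: contraTneq Akk => ->; rewrite mul0r ltxx.
  have Akj : 0 < A k j.
    by rewrite lt_def A0 andbT; apply: contraTneq Akk => ->; rewrite mulr0 ltxx.
  have uk : 0 < (A *m v) k 0.
    rewrite mxE (bigD1 j)//= ltr_pwDl ?mulr_gt0//.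
    by apply: sumr_ge0 => l _; rewrite mulr_ge0.
  have : 0 < g * v i 0 `^ (r - 1).
    rewrite hg (bigD1 k)//= ltr_pwDl ?mulr_gt0 ?powR_gt0//.
    by apply: sumr_ge0 => l _; rewrite mulr_ge0 ?powR_ge0.
  by rewrite pmulr_rgt0//; apply: gt0_powR; rewrite ?subr_gt0.
- have : \sum_i v i 0 `^ r <> 0 by rewrite sv; exact/eqP/oner_neq0.
  move=> /psumr_neq0P[i _|i /= vi]; first exact: powR_ge0.
  by exists i; apply: gt0_powR vi; rewrite ?(lt_trans ltr01 r1).
Qed.

(** * Almost regular matrices: bounds at the extremal entries *)

Definition row_sums_within (R : realType) (n : nat) (D e : R)
    (A : 'M[R]_n) : Prop :=
  forall i, D * (1 - e) <= row_sum A i <= D * (1 + e).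

Lemma row_sums_within_le (R : realType) (n : nat) (D e hi : R) (A : 'M[R]_n)
    (x : 'I_n -> R) (i : 'I_n) : (forall i j, 0 <= A i j) ->
  row_sums_within D e A -> 0 <= hi -> (forall j, x j <= hi) ->
  \sum_j A i j * x j <= D * (1 + e) * hi.
Proof.
move=> A0 /(_ i)/andP[_ d] h0 xh; apply: (@le_trans _ _ (row_sum A i * hi)).
  by rewrite mulr_suml; apply: ler_sum => j _; rewrite ler_wpM2l.
by rewrite ler_wpM2r.
Qed.

Lemma row_sums_within_ge (R : realType) (n : nat) (D e lo : R) (A : 'M[R]_n)
    (x : 'I_n -> R) (i : 'I_n) : (forall i j, 0 <= A i j) ->
  row_sums_within D e A -> 0 <= lo -> (forall j, lo <= x j) ->
  D * (1 - e) * lo <= \sum_j A i j * x j.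
Proof.
move=> A0 /(_ i)/andP[d _] h0 xh; apply: (@le_trans _ _ (row_sum A i * lo)).
  by rewrite ler_wpM2r.
by rewrite mulr_suml; apply: ler_sum => j _; rewrite ler_wpM2l.
Qed.

(** The critical equation at an index where [v] is smallest, respectively
    largest: there every entry of [v] can be replaced by the extremal one, and
    row sums are all that is left of [A]. *)
Lemma critical_value_bounds (R : realType) (n : nat) (r p D e g : R)
    (A : 'M[R]_n) (v : 'cV[R]_n) (i0 j0 : 'I_n) :
  1 < p -> 0 < D -> 0 < e < 1 -> (forall i j, 0 <= A i j) ->
  row_sums_within D e A -> 0 < v j0 0 ->
  (forall i, v j0 0 <= v i 0 <= v i0 0) ->
  (forall i, g * v i 0 `^ (r - 1) = \sum_k A i k * (A *m v) k 0 `^ (p - 1)) ->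
  (D * (1 - e)) `^ p <= g * v j0 0 `^ (r - p) /\
  g * v i0 0 `^ (r - p) <= (D * (1 + e)) `^ p.
Proof.
move=> p1 D0 /andP[e0 e1] A0 dA m0 mM crit.
have p0 : 0 < p := lt_trans ltr01 p1.
have p10 : 0 <= p - 1 by rewrite subr_ge0 ltW.
have M0 : 0 < v i0 0 by case/andP: (mM j0) => _; exact: lt_le_trans.
have split_r (x : R) : 0 < x -> x `^ (r - 1) = x `^ (r - p) * x `^ (p - 1).
  by move=> x0; rewrite -powRD ?(gt_eqF x0) ?implybT//; congr (_ `^ _); ring.
have eq_p (c x : R) : 0 < c -> 0 <= x ->
    c * (c * x) `^ (p - 1) = c `^ p * x `^ (p - 1).
  by move=> c0 x0; rewrite powRM ?(ltW c0)// mulrA mulr_powRB1 ?(ltW c0).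
have De0 : 0 < D * (1 - e) by rewrite mulr_gt0 ?subr_gt0.
have De1 : 0 < D * (1 + e) by rewrite mulr_gt0 ?addr_gt0.
have u_ge k : D * (1 - e) * v j0 0 <= (A *m v) k 0.
  rewrite mxE; apply: row_sums_within_ge => //; first exact: ltW.
  by move=> j; case/andP: (mM j).
have u_le k : (A *m v) k 0 <= D * (1 + e) * v i0 0.
  rewrite mxE; apply: row_sums_within_le => //; first exact: ltW.
  by move=> j; case/andP: (mM j).
have Y0 : 0 < D * (1 - e) * v j0 0 by rewrite mulr_gt0.
have X0 : 0 < D * (1 + e) * v i0 0 by rewrite mulr_gt0.
have u0 k : 0 <= (A *m v) k 0 by apply: le_trans (u_ge k); exact: ltW.
split.
- rewrite -(@ler_pM2r _ (v j0 0 `^ (p - 1))) ?powR_gt0// -mulrA -split_r// crit.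
  rewrite -eq_p ?(ltW m0)//; apply: row_sums_within_ge; rewrite ?powR_ge0// => k.
  by apply: ge0_ler_powR; rewrite ?nnegrE ?(ltW Y0).
- rewrite -(@ler_pM2r _ (v i0 0 `^ (p - 1))) ?powR_gt0// -mulrA -split_r// crit.
  rewrite -eq_p ?(ltW M0)//; apply: row_sums_within_le; rewrite ?powR_ge0// => k.
  by apply: ge0_ler_powR; rewrite ?nnegrE ?(ltW X0).
Qed.

(** In the subcritical case the unknown [g] is bounded below by the minimum and
    above by the maximum; eliminating it bounds a positive power of their
    ratio. *)
Lemma critical_ratio_le (R : realType) (n : nat) (r p D e g : R)
    (A : 'M[R]_n) (v : 'cV[R]_n) (i0 j0 : 'I_n) :
  1 < p -> p < r -> 0 < D -> 0 < e < 1 -> (forall i j, 0 <= A i j) ->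
  row_sums_within D e A -> 0 < v j0 0 ->
  (forall i, v j0 0 <= v i 0 <= v i0 0) ->
  (forall i, g * v i 0 `^ (r - 1) = \sum_k A i k * (A *m v) k 0 `^ (p - 1)) ->
  v i0 0 <= v j0 0 * ((1 + e) / (1 - e)) `^ (p / (r - p)).
Proof.
move=> p1 pr D0 e01 A0 dA m0 mM crit.
have [lo hi] := critical_value_bounds p1 D0 e01 A0 dA m0 mM crit.
case/andP: e01 => e0 e1.
have M0 : 0 < v i0 0 by case/andP: (mM j0) => _; exact: lt_le_trans.
have q0 : 0 < r - p by rewrite subr_gt0.
have w0 : 0 < 1 - e by rewrite subr_gt0.
have W0 : 0 < 1 + e by rewrite addr_gt0.
rewrite leNgt; apply/negP => gtM.
have := gt0_ltr_powR q0 _ _ gtM.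
rewrite !nnegrE mulr_ge0 ?powR_ge0 ?(ltW m0)// (ltW M0) => /(_ isT isT).
rewrite powRM ?powR_ge0 ?(ltW m0)// -powRrM divfK ?gt_eqF//.
have -> : (1 + e) / (1 - e) = (D * (1 + e)) / (D * (1 - e)).
  by field; rewrite !gt_eqF.
rewrite powRM ?invr_ge0 ?mulr_ge0 ?ltW//.
rewrite -powR_inv1 ?mulr_ge0 ?(ltW w0) ?(ltW D0)// powRAC powR_inv1 ?powR_ge0//.
have P0 : 0 < (D * (1 - e)) `^ p by rewrite powR_gt0 ?mulr_gt0.
rewrite mulrA ltr_pdivrMr//.
have m1 : 0 < v j0 0 `^ (r - p) by rewrite powR_gt0.
have M1 : 0 < v i0 0 `^ (r - p) by rewrite powR_gt0.
move: (v j0 0 `^ _) (v i0 0 `^ _) (_ `^ p) (_ `^ p) m1 M1 P0 lo hi => m M P Q.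
by move=> m1 M1 P0 lo hi; nra.
Qed.

(** As [v] has unit norm, the constant unit vector lies entrywise between the
    extremal entries of [v]; so their difference controls the distance. The
    bound on the minimum is handed to the user, who needs it to turn a relative
    oscillation into an absolute one. *)
Lemma dist_const_le (R : realType) (n : nat) (r B : R) (v : 'cV[R]_n)
    (i0 j0 : 'I_n) : 1 < r -> 0 < v j0 0 ->
  (forall i, v j0 0 <= v i 0 <= v i0 0) -> \sum_i v i 0 `^ r = 1 ->
  (v j0 0 <= n%:R `^ (- (1 / r)) -> v i0 0 - v j0 0 <= B) ->
  `|v - const_mx (n%:R `^ (- (1 / r)))| <= B.
Proof.
move=> r1 m0 mM sv.
have r0 : 0 < r := lt_trans ltr01 r1.
have M0 : 0 < v i0 0 by case/andP: (mM j0) => _; exact: lt_le_trans.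
have n0 : 0 < n%:R :> R by rewrite ltr0n; case: n i0 {v j0 m0 mM sv M0} => [[]|].
have -> : n%:R `^ (- (1 / r)) = (n%:R^-1) `^ r^-1 :> R.
  by rewrite -(@powR_inv1 R n%:R) ?ler0n// -powRrM mulN1r div1r.
have sc (x : R) : \sum_(i < n) x = n%:R * x.
  by rewrite sumr_const card_ord mulr_natl.
have mn : v j0 0 <= (n%:R^-1) `^ r^-1.
  rewrite -(powR_KV r0 (ltW m0)) powR_inv_le ?powR_ge0 ?invr_ge0 ?(ltW n0)//.
  rewrite -(ler_pM2l n0) divff ?gt_eqF// -[leRHS]sv -sc; apply: ler_sum => i _.
  case/andP: (mM i) => H _; have vi0 := lt_le_trans m0 H.
  by apply: ge0_ler_powR; rewrite ?nnegrE// ltW.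
have Mn : (n%:R^-1) `^ r^-1 <= v i0 0.
  rewrite -[leRHS](powR_KV r0 (ltW M0)) powR_inv_le ?powR_ge0 ?invr_ge0 ?(ltW n0)//.
  rewrite -(ler_pM2l n0) divff ?gt_eqF// -[leLHS]sv -sc; apply: ler_sum => i _.
  case/andP: (mM i) => H H'; have vi0 := lt_le_trans m0 H.
  by apply: ge0_ler_powR; rewrite ?nnegrE// ltW.
move=> /(_ mn) HB; rewrite [X in X <= _]mx_normrE.
apply: bigmax_le => [|[i j] _ /=].
  by apply: le_trans HB; rewrite subr_ge0 (le_trans mn).
rewrite !mxE ord1 ler_norml; case/andP: (mM i) => H H'.
by move: (_ `^ _) mn Mn => x; lra.
Qed.

(** * Well-connected matrices: comparison with the mean *)

(** Well-connectedness says that two steps along [A] reach every index with at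
    least a fixed share of the uniform weight; so they see the mean. *)
Lemma two_step_sum_ge (R : realType) (n : nat) (C mu : R) (A : 'M[R]_n)
    (w : 'I_n -> R) (i : 'I_n) : (0 < n)%N ->
  (forall i j, C * n%:R * mu ^+ 2 <= \sum_k A i k * A k j) ->
  (forall j, 0 <= w j) ->
  C * (n%:R * mu) ^+ 2 * ((\sum_j w j) / n%:R) <=
    \sum_k A i k * \sum_j A k j * w j.
Proof.
move=> n0 wc w0.
have nR : n%:R != 0 :> R by rewrite pnatr_eq0 -lt0n.
have -> : \sum_k A i k * \sum_j A k j * w j =
    \sum_j (\sum_k A i k * A k j) * w j.
  under eq_bigr do rewrite mulr_sumr.
  rewrite exchange_big /=; apply: eq_bigr => j _.
  by rewrite mulr_suml; apply: eq_bigr => k _; rewrite mulrA.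
have -> : C * (n%:R * mu) ^+ 2 * ((\sum_j w j) / n%:R) =
    \sum_j (C * n%:R * mu ^+ 2) * w j.
  by rewrite -mulr_sumr; field.
by apply: ler_sum => j _; rewrite ler_wpM2r.
Qed.

(** What the critical equation for [p = r] says about the maximum [M], the
    minimum [m] and the mean [a] of the maximizer, with [D] the ideal row sum.
    The numbers [Y] and [X] enclose the entries of [A *m v]. The unspecified
    slopes [k1] and [k2], in units of [D `^ (r - 2)], are lower bounds for the
    slopes of the chords of the power [r - 1] that end at [X], respectively
    start at [Y]: which of them are useful depends on [r], and the case [2 < r]
    needs two successive choices. *)
Definition gap_defect (R : realType) (r D e C M m a : R) : Prop :=
  forall (k1 k2 : R) (X := D * (1 + e) * M) (Y := D * (1 - e) * m),
  0 <= k1 -> 0 <= k2 ->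
  (forall u, Y <= u <= X ->
     D `^ (r - 2) * k1 * (X - u) <= X `^ (r - 1) - u `^ (r - 1)) ->
  (forall u, Y <= u <= X ->
     D `^ (r - 2) * k2 * (u - Y) <= u `^ (r - 1) - Y `^ (r - 1)) ->
  k1 * C * (M - a) <= ((1 + e) `^ r - (1 - e) `^ r) * M `^ (r - 1) /\
  k2 * C * (a - m) <= ((1 + e) `^ r - (1 - e) `^ r) * m `^ (r - 1).

(** Spectral gap argument. At the index of the maximum, the right-hand side of
    the critical equation would be [D * (1 + e) * X `^ (r - 1)] if all entries
    of [A *m v] were as large as [X]. Each shortfall [X - u] lowers it by at
    least the slope times [X - u], and the total shortfall, being a two-step
    sum of [v i0 0 - v j 0], is at least proportional to the distance from the
    maximum to the mean. On the other hand [g] cannot be below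
    [(D * (1 - e)) `^ r]. The minimum is treated symmetrically. *)
Lemma critical_gap_defect (R : realType) (n : nat) (r mu e g C : R)
    (A : 'M[R]_n) (v : 'cV[R]_n) (i0 j0 : 'I_n) :
  1 < r -> 0 < mu -> 0 < e < 1 -> (forall i j, 0 <= A i j) ->
  row_sums_within (n%:R * mu) e A ->
  (forall i j, C * n%:R * mu ^+ 2 <= \sum_k A i k * A k j) ->
  0 < v j0 0 -> (forall i, v j0 0 <= v i 0 <= v i0 0) ->
  (forall i, g * v i 0 `^ (r - 1) = \sum_k A i k * (A *m v) k 0 `^ (r - 1)) ->
  gap_defect r (n%:R * mu) e C (v i0 0) (v j0 0) ((\sum_i v i 0) / n%:R).
Proof.
move=> r1 mu0 e01 A0 dA wc m0 mM crit k1 k2 X Y k10 k20 hX hY.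
have n0 : (0 < n)%N.
  by case: n i0 {v j0 X Y A A0 dA wc m0 mM crit hX hY} => [[]|].
pose D := n%:R * mu; pose mean := (\sum_i v i 0) / n%:R.
rewrite -/D -/mean in hX hY *.
have nR0 : 0 < n%:R :> R by rewrite ltr0n.
have D0 : 0 < D by rewrite mulr_gt0.
have [] := critical_value_bounds r1 D0 e01 A0 dA m0 mM crit.
rewrite subrr !powRr0 mulr1 => g_ge g_le.
case/andP: (e01) => e0 e1.
have M0 : 0 < v i0 0 by case/andP: (mM j0) => _; exact: lt_le_trans.
have w0 : 0 < 1 - e by rewrite subr_gt0.
have W0 : 0 < 1 + e by rewrite addr_gt0.
have r10 : 0 <= r - 1 by rewrite subr_ge0 ltW.
have Dr : D `^ (r - 2) * D ^+ 2 = D `^ r.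
  rewrite -[X in _ * X]powR_mulrn ?(ltW D0)// -powRD ?(gt_eqF D0) ?implybT//.
  by rewrite subrK.
have Dr0 : 0 < D `^ r by rewrite powR_gt0.
have Dk0 k : 0 <= k -> 0 <= D `^ (r - 2) * k.
  by move=> ?; rewrite mulr_ge0 ?powR_ge0.
have sc (x : R) : \sum_(i < n) x = n%:R * x.
  by rewrite sumr_const card_ord mulr_natl.
have eq_r (c x : R) : 0 < c -> 0 <= x ->
    D * c * (D * c * x) `^ (r - 1) = D `^ r * c `^ r * x `^ (r - 1).
  move=> c0 x0; have Dc0 : 0 < D * c by rewrite mulr_gt0.
  rewrite powRM ?(ltW Dc0)// mulrA mulr_powRB1 ?(ltW Dc0) ?(lt_trans ltr01)//.
  by rewrite powRM ?(ltW D0) ?(ltW c0).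
have uY k : Y <= (A *m v) k 0.
  rewrite mxE; apply: row_sums_within_ge => //; first exact: ltW.
  by move=> j; case/andP: (mM j).
have uX k : (A *m v) k 0 <= X.
  rewrite mxE; apply: row_sums_within_le => //; first exact: ltW.
  by move=> j; case/andP: (mM j).
rewrite (powRM r (ltW D0) (ltW w0)) in g_ge.
rewrite (powRM r (ltW D0) (ltW W0)) in g_le.
split.
- have step : C * D ^+ 2 * (v i0 0 - mean) <=
      \sum_k A i0 k * (X - (A *m v) k 0).
    have -> : v i0 0 - mean = (\sum_j (v i0 0 - v j 0)) / n%:R.
      by rewrite sumrB sc mulrBl mulrAC divff ?gt_eqF// mul1r.
    apply: le_trans (two_step_sum_ge _ n0 wc _) _ => [j|].
      by rewrite subr_ge0; case/andP: (mM j).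
    apply: ler_sum => k _; apply: ler_wpM2l => //; rewrite mxE.
    under eq_bigr do rewrite mulrBr.
    rewrite sumrB lerB//.
    by apply: row_sums_within_le => //; exact: ltW.
  (* weigh the slope inequality at u := (A *m v) k 0 by A i0 k and sum *)
  have sums : g * v i0 0 `^ (r - 1) +
      D `^ (r - 2) * k1 * \sum_k A i0 k * (X - (A *m v) k 0) <=
      D `^ r * (1 + e) `^ r * v i0 0 `^ (r - 1).
    rewrite -eq_r ?(ltW M0)// crit mulr_sumr -big_split /=.
    apply: le_trans (row_sums_within_le i0 A0 dA (powR_ge0 _ _)
      (fun=> lexx (X `^ (r - 1)))).
    apply: ler_sum => k _; have := hX ((A *m v) k 0); rewrite uY uX => /(_ isT).
    move=> /(ler_wpM2l (A0 i0 k)); rewrite mulrBr; lra.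
  have gM := ler_wpM2r (powR_ge0 (v i0 0) (r - 1)) g_ge.
  have := ler_wpM2l (Dk0 _ k10) step.
  have -> : D `^ (r - 2) * k1 * (C * D ^+ 2 * (v i0 0 - mean)) =
      D `^ r * (k1 * C * (v i0 0 - mean)) by rewrite -Dr; ring.
  move=> gap; rewrite -(ler_pM2l Dr0).
  by move: sums gM gap; lra.
- have step : C * D ^+ 2 * (mean - v j0 0) <=
      \sum_k A j0 k * ((A *m v) k 0 - Y).
    have -> : mean - v j0 0 = (\sum_j (v j 0 - v j0 0)) / n%:R.
      by rewrite sumrB sc mulrBl [n%:R * _ / _]mulrAC divff ?gt_eqF// mul1r.
    apply: le_trans (two_step_sum_ge _ n0 wc _) _ => [j|].
      by rewrite subr_ge0; case/andP: (mM j).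
    apply: ler_sum => k _; apply: ler_wpM2l => //; rewrite mxE.
    under eq_bigr do rewrite mulrBr.
    rewrite sumrB lerB//.
    by apply: row_sums_within_ge => //; exact: ltW.
  have sums : D `^ r * (1 - e) `^ r * v j0 0 `^ (r - 1) +
      D `^ (r - 2) * k2 * \sum_k A j0 k * ((A *m v) k 0 - Y) <=
      g * v j0 0 `^ (r - 1).
    rewrite -eq_r ?(ltW m0)// crit.
    rewrite -lerBrDr mulr_sumr -sumrB.
    apply: le_trans (row_sums_within_ge j0 A0 dA (powR_ge0 _ _)
      (fun=> lexx (Y `^ (r - 1)))) _.
    apply: ler_sum => k _; have := hY ((A *m v) k 0); rewrite uY uX => /(_ isT).
    move=> /(ler_wpM2l (A0 j0 k)); rewrite mulrBr; lra.
  have gm := ler_wpM2r (powR_ge0 (v j0 0) (r - 1)) g_le.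
  have := ler_wpM2l (Dk0 _ k20) step.
  have -> : D `^ (r - 2) * k2 * (C * D ^+ 2 * (mean - v j0 0)) =
      D `^ r * (k2 * C * (mean - v j0 0)) by rewrite -Dr; ring.
  move=> gap; rewrite -(ler_pM2l Dr0).
  by move: sums gm gap; lra.
Qed.

(** * From the gap defect to the oscillation *)

Lemma powR1D_sub_powR1B_le (R : realType) (r e : R) : 1 < r -> 0 < e ->
  r * e <= 20^-1 ->
  0 <= (1 + e) `^ r - (1 - e) `^ r <= 21 / 10 * (r * e).
Proof.
move=> r1 e0 re.
have r0 : 0 < r := lt_trans ltr01 r1.
have e1 : e <= 1 by nra.
apply/andP; split.
  by rewrite subr_ge0; apply: ge0_ler_powR; rewrite ?nnegrE; lra.
have hi : (1 + e) `^ r <= 1 + r * e + 2 * (r * e) ^+ 2.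
  by apply: powR1D_le; lra.
have lo : r * 1 `^ (r - 1) * (1 - e - 1) <= (1 - e) `^ r - 1 `^ r.
  by apply: powR_ge_tangent; lra.
move: lo; rewrite !powR1 mulr1 => lo.
have z0 : 0 <= r * e by rewrite mulr_ge0 ?ltW.
by move: (_ `^ r) (_ `^ r) hi lo => P Q hi lo; nra.
Qed.

Lemma scaled_powR (R : realType) (D c x r : R) : 0 < D -> 0 < c -> 0 < x ->
  (D * c * x) `^ (r - 1 - 1) =
    D `^ (r - 2) * (c `^ (r - 1 - 1) * x `^ (r - 1 - 1)).
Proof.
move=> D0 c0 x0; rewrite (_ : r - 2 = r - 1 - 1); last by ring.
by rewrite -!powRM ?mulr_ge0 ?(ltW D0) ?(ltW c0) ?(ltW x0)// mulrA.
Qed.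

(** For [r <= 2] the smallest slope is the one at the upper end [X]. It is
    comparable with [M `^ (r - 2)] as it stands, so both halves of the gap
    defect can be added directly. *)
Lemma gap_osc_le_concave (R : realType) (r D e C M m a : R) :
  1 < r -> r - 1 <= 1 -> 0 < D -> 0 < e < 1 -> 0 < C -> 0 < m -> m <= M ->
  gap_defect r D e C M m a -> r * e <= 20^-1 ->
  (r - 1) * C * (M - m) <= 5 * (r * e) * M.
Proof.
move=> r1 b1 D0 /andP[e0 e1] C0 m0 mM gap re.
have r0 : 0 < r := lt_trans ltr01 r1.
have b0 : 0 < r - 1 by rewrite subr_gt0.
have M0 : 0 < M := lt_le_trans m0 mM.
have w0 : 0 < 1 - e by rewrite subr_gt0.
have W0 : 0 < 1 + e by rewrite addr_gt0.
have /andP[G0 GB] := powR1D_sub_powR1B_le r1 e0 re.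
pose X := D * (1 + e) * M; pose Y := D * (1 - e) * m.
have Y0 : 0 < Y by rewrite !mulr_gt0.
pose P := M `^ (r - 1 - 1); pose W := (1 + e) `^ (r - 1 - 1).
have P0 : 0 < P by rewrite powR_gt0.
have MP : M `^ (r - 1) = P * M by rewrite mulrC mulr_powRB1 ?(ltW M0).
(* W may be below 1 because its exponent is nonpositive *)
have W1 : 1 <= (1 + e) * W.
  rewrite mulr_powRB1 ?(ltW W0)// -[leLHS](powRr0 (1 + e)).
  by apply: ler_powR; rewrite ?lerDl ?(ltW e0) ?(ltW b0).
have k0 : 0 <= (r - 1) * (W * P) by rewrite !mulr_ge0 ?powR_ge0 ?(ltW b0).
have secant s t : Y <= s -> s <= t -> t <= X ->
    D `^ (r - 2) * ((r - 1) * (W * P)) * (t - s) <= t `^ (r - 1) - s `^ (r - 1).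
  move=> Ys st tX; rewrite mulrCA -scaled_powR//.
  apply: (powR_secant_ge b0 Y0 _ _ Ys st tX) => //.
  apply: powR_le_npow; rewrite ?subr_le0//.
  by rewrite (le_trans Ys) ?(le_trans st).
have [||top bot] := gap _ _ k0 k0.
- by move=> u /andP[Yu uX]; apply: secant.
- by move=> u /andP[Yu uX]; apply: secant => //; exact: le_trans uX.
have mP : m `^ (r - 1) <= P * M.
  by rewrite -MP; apply: ge0_ler_powR; rewrite ?nnegrE ?(ltW b0) ?(ltW m0) ?(ltW M0).
set G := _ - _ in G0 GB top bot.
have sum : (r - 1) * C * (M - m) * W <= 2 * G * M.
  rewrite -(ler_pM2l P0); move: (ler_wpM2l G0 mP) top bot; rewrite MP.
  by clear => *; lra.
have osc0 : 0 <= (r - 1) * C * (M - m).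
  by rewrite !mulr_ge0 ?(ltW b0) ?(ltW C0) ?subr_ge0.
have le1 : (r - 1) * C * (M - m) <= (1 + e) * (2 * G * M).
  apply: (@le_trans _ _ ((1 + e) * ((r - 1) * C * (M - m) * W))).
    by rewrite mulrCA ler_peMr.
  by rewrite ler_wpM2l ?(ltW W0).
have e20 : e <= 20^-1 by apply: le_trans re; rewrite ler_peMl ?ltW.
have GM : G * M <= 21 / 10 * (r * e) * M by rewrite ler_wpM2r ?(ltW M0).
have eGM : e * (G * M) <= 20^-1 * (G * M).
  by rewrite ler_wpM2r// mulr_ge0 ?(ltW M0).
have reM : 0 <= r * e * M by rewrite !mulr_ge0 ?ltW.
by move: le1 GM eGM reM; clear => *; lra.
Qed.

(** For [2 <= r] the smallest slope is the one at [Y], which is of no use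
    before [m] is known to be comparable to [M]. A first bound uses instead
    that a chord is at least as steep as the line from the origin to either of
    its ends. This loses a factor [r - 1] in the final constant. *)
Lemma gap_osc_le_convex_crude (R : realType) (r D e C M m a : R) :
  1 < r -> 1 <= r - 1 -> 0 < D -> 0 < e < 1 -> 0 < C -> 0 < m -> m <= M ->
  gap_defect r D e C M m a -> r * e <= 20^-1 ->
  19 / 20 <= (1 - e) `^ (r - 1 - 1) ->
  C * (M - m) <= 5 * (r * e) * M.
Proof.
move=> r1 b1 D0 /andP[e0 e1] C0 m0 mM gap re w95.
have r0 : 0 < r := lt_trans ltr01 r1.
have b0 : 0 < r - 1 by rewrite subr_gt0.
have b10 : 0 <= r - 1 - 1 by rewrite subr_ge0.
have M0 : 0 < M := lt_le_trans m0 mM.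
have w0 : 0 < 1 - e by rewrite subr_gt0.
have W0 : 0 < 1 + e by rewrite addr_gt0.
have /andP[G0 GB] := powR1D_sub_powR1B_le r1 e0 re.
have Y0 : 0 < D * (1 - e) * m by rewrite !mulr_gt0.
have chord (s t : R) : 0 < s -> s <= t ->
    s `^ (r - 1 - 1) * (t - s) <= t `^ (r - 1) - s `^ (r - 1) /\
    t `^ (r - 1 - 1) * (t - s) <= t `^ (r - 1) - s `^ (r - 1).
  move=> s0 st; have t0 := lt_le_trans s0 st.
  have ST : s `^ (r - 1 - 1) <= t `^ (r - 1 - 1).
    by apply: ge0_ler_powR; rewrite ?nnegrE ?(ltW s0) ?(ltW t0).
  rewrite -(mulr_powRB1 (ltW s0) b0) -(mulr_powRB1 (ltW t0) b0).
  have := ler_wpM2l (ltW s0) ST; have := ler_wpM2l (ltW t0) ST.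
  by clear => *; split; lra.
have [||||top bot] := gap ((1 + e) `^ (r - 1 - 1) * M `^ (r - 1 - 1))
    ((1 - e) `^ (r - 1 - 1) * m `^ (r - 1 - 1)).
- by rewrite mulr_ge0 ?powR_ge0.
- by rewrite mulr_ge0 ?powR_ge0.
- move=> u /andP[Yu uX]; rewrite -scaled_powR//.
  by have [] := chord _ _ (lt_le_trans Y0 Yu) uX.
- move=> u /andP[Yu uX]; rewrite -scaled_powR//.
  by have [] := chord _ _ Y0 Yu.
move: top bot; rewrite -(mulr_powRB1 (ltW M0) b0) -(mulr_powRB1 (ltW m0) b0).
have W1 : 1 <= (1 + e) `^ (r - 1 - 1).
  by rewrite -[leLHS](powRr0 (1 + e)); apply: ler_powR; rewrite ?lerDl ?(ltW e0).
have P0 : 0 < M `^ (r - 1 - 1) by rewrite powR_gt0.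
have Q0 : 0 < m `^ (r - 1 - 1) by rewrite powR_gt0.
move: ((1 + e) `^ (r - 1 - 1)) ((1 - e) `^ (r - 1 - 1)) W1 w95 => W w W1 w95.
move: (M `^ _) (m `^ _) P0 Q0 => P Q P0 Q0.
set G := _ - _ in G0 GB * => top bot.
have {}top : W * (C * (M - a)) <= G * M.
  by rewrite -(ler_pM2l P0); move: top; clear => *; lra.
have {}bot : w * (C * (a - m)) <= G * m.
  by rewrite -(ler_pM2l Q0); move: bot; clear => *; lra.
have GM : G * M <= 21 / 10 * (r * e) * M by rewrite ler_wpM2r ?(ltW M0).
have Gm : G * m <= G * M by rewrite ler_wpM2l.
have GM0 : 0 <= G * M by rewrite mulr_ge0 ?(ltW M0).
(* dividing by W or w is only legitimate on nonnegative quantities *)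
have unscale (c c' z B : R) : 0 < c -> c <= c' -> 0 <= B -> c' * z <= B -> c * z <= B.
  move=> c0 cc B0; have [z0|z0] := leP 0 z.
    by apply: le_trans; rewrite ler_wpM2r.
  by move=> _; apply: le_trans B0; rewrite pmulr_rle0// ltW.
have ha := unscale _ _ _ _ ltr01 W1 GM0 top.
have c95 : 0 < 19 / 20 :> R by lra.
have hb := unscale _ _ _ _ c95 w95 GM0 (le_trans bot Gm).
have reM : 0 <= r * e * M by rewrite !mulr_ge0 ?ltW.
by move: ha hb GM reM; clear => *; lra.
Qed.

(** Once the crude bound has shown that [m / M] is close to 1, the slope at [Y]
    is almost that at [X], and the missing factor [r - 1] is recovered. *)
Lemma gap_osc_le_convex (R : realType) (r D e C M m a : R) :
  1 < r -> 1 <= r - 1 -> 0 < D -> 0 < e < 1 -> 0 < C -> 0 < m -> m <= M ->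
  gap_defect r D e C M m a -> r * e <= 20^-1 -> 100 * (r * e) * (r - 1) <= C ->
  (r - 1) * C * (M - m) <= 5 * (r * e) * M.
Proof.
move=> r1 b1 D0 e01 C0 m0 mM gap re reC.
have /andP[e0 e1] := e01.
have r0 : 0 < r := lt_trans ltr01 r1.
have b0 : 0 < r - 1 by rewrite subr_gt0.
have b10 : 0 <= r - 1 - 1 by rewrite subr_ge0.
have M0 : 0 < M := lt_le_trans m0 mM.
have w0 : 0 < 1 - e by rewrite subr_gt0.
have W0 : 0 < 1 + e by rewrite addr_gt0.
have /andP[G0 GB] := powR1D_sub_powR1B_le r1 e0 re.
pose X := D * (1 + e) * M; pose Y := D * (1 - e) * m.
have X0 : 0 < X by rewrite !mulr_gt0.
have Y0 : 0 < Y by rewrite !mulr_gt0.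
pose w := (1 - e) `^ (r - 1 - 1).
have w95 : 19 / 20 <= w.
  have := powR_ge_tangent b1 ler01 (ltW w0).
  rewrite !powR1 mulr1 -(mulr_powRB1 (ltW w0) b0) -/w => tangent.
  have we : (1 - e) * w <= w by rewrite ler_piMl ?powR_ge0// gerBl ltW.
  by move: tangent we re e0; clear => *; lra.
have crude := gap_osc_le_convex_crude r1 b1 D0 e01 C0 m0 mM gap re w95.
pose P := M `^ (r - 1 - 1); pose Q := m `^ (r - 1 - 1).
have P0 : 0 < P by rewrite powR_gt0.
have Q0 : 0 < Q by rewrite powR_gt0.
have MP : M `^ (r - 1) = P * M by rewrite mulrC mulr_powRB1 ?(ltW M0).
have mQ : m `^ (r - 1) = Q * m by rewrite mulrC mulr_powRB1 ?(ltW m0).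
(* the crude bound makes M / m so close to 1 that even its powers are *)
have low : 19 / 20 * P <= Q.
  have osc : (r - 1) * (M - m) <= M / 20.
    rewrite -(ler_pM2l C0).
    have := ler_wpM2r (ltW M0) reC; have := ler_wpM2l (ltW b0) crude.
    by clear => *; lra.
  have := powR_ge_tangent b1 (ltW M0) (ltW m0); rewrite MP mQ -/P => tangent.
  rewrite -(ler_pM2r M0).
  have := ler_wpM2l (ltW P0) osc; have := ler_wpM2l (ltW Q0) mM.
  by move: tangent; clear => *; lra.
have wQ : 9 / 10 * P <= w * Q.
  by have := ler_wpM2r (ltW Q0) w95; move: P0 low; clear => *; lra.
have k0 : 0 <= (r - 1) * (w * Q) by rewrite !mulr_ge0 ?powR_ge0 ?(ltW b0).
have secant s t : Y <= s -> s <= t -> t <= X ->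
    D `^ (r - 2) * ((r - 1) * (w * Q)) * (t - s) <= t `^ (r - 1) - s `^ (r - 1).
  move=> Ys st tX; rewrite mulrCA -scaled_powR//.
  apply: (powR_secant_ge b0 Y0 _ _ Ys st tX) => //.
  apply: ge0_ler_powR; rewrite ?nnegrE ?(ltW X0) ?(ltW Y0)//.
  by rewrite (le_trans Ys) ?(le_trans st).
have [||top bot] := gap _ _ k0 k0.
- by move=> u /andP[Yu uX]; apply: secant.
- by move=> u /andP[Yu uX]; apply: secant => //; exact: le_trans uX.
have mP : m `^ (r - 1) <= P * M.
  by rewrite -MP; apply: ge0_ler_powR; rewrite ?nnegrE ?(ltW b0) ?(ltW m0) ?(ltW M0).
set G := _ - _ in G0 GB top bot.
have osc0 : 0 <= (r - 1) * C * (M - m).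
  by rewrite !mulr_ge0 ?(ltW b0) ?(ltW C0) ?subr_ge0.
have wQosc := ler_wpM2r osc0 wQ.
have PM0 : 0 <= P * M by rewrite mulr_ge0 ?(ltW P0) ?(ltW M0).
have re0 : 0 <= r * e by rewrite mulr_ge0 ?(ltW r0) ?(ltW e0).
have rePM : 0 <= r * e * (P * M) by exact: mulr_ge0.
have GPM := ler_wpM2r PM0 GB.
have Gm := ler_wpM2l G0 mP.
rewrite -(ler_pM2l P0).
by move: top bot wQosc rePM GPM Gm; rewrite MP; clear => *; lra.
Qed.

Lemma critical_osc_le (R : realType) (n : nat) (r mu e g C : R)
    (A : 'M[R]_n) (v : 'cV[R]_n) (i0 j0 : 'I_n) :
  1 < r -> 0 < mu -> 0 < e < 1 -> (forall i j, 0 <= A i j) ->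
  row_sums_within (n%:R * mu) e A ->
  (forall i j, C * n%:R * mu ^+ 2 <= \sum_k A i k * A k j) -> 0 < C ->
  0 < v j0 0 -> (forall i, v j0 0 <= v i 0 <= v i0 0) ->
  (forall i, g * v i 0 `^ (r - 1) = \sum_k A i k * (A *m v) k 0 `^ (r - 1)) ->
  r * e <= 20^-1 -> 100 * (r * e) * (r - 1) <= C ->
  (r - 1) * C * (v i0 0 - v j0 0) <= 5 * (r * e) * v i0 0.
Proof.
move=> r1 mu0 e01 A0 dA wc C0 m0 mM crit re reC.
have gap := critical_gap_defect r1 mu0 e01 A0 dA wc m0 mM crit.
have n0 : 0 < n%:R :> R.
  by rewrite ltr0n; case: n i0 {v j0 A A0 dA wc m0 mM crit gap} => [[]|].
have D0 : 0 < n%:R * mu by rewrite mulr_gt0.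
have mleM : v j0 0 <= v i0 0 by case/andP: (mM j0).
have [b1|/ltW b1] := leP (r - 1) 1.
- exact: gap_osc_le_concave gap re.
- exact: gap_osc_le_convex gap re reC.
Qed.

(** * Distance to the constant vector *)

(** Comparison with the constant unit vector, whose image is positive because
    the row sums are, shows that [A *m v] is nonzero. *)
Lemma argmax_extremal_critical (R : realType) (n : nat) (r p D e : R)
    (A : 'M[R]_n) (v : 'cV[R]_n) : (0 < n)%N -> 1 < r -> 1 < p ->
  A^T = A -> (forall i j, 0 <= A i j) -> irreducible_mx (A^T *m A) ->
  0 < D -> e < 1 -> row_sums_within D e A ->
  is_argmax_rp r p A v -> (forall i, 0 <= v i 0) ->
  exists i0 j0 : 'I_n, [/\ 0 < v j0 0,
    forall i, v j0 0 <= v i 0 <= v i0 0,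
    \sum_i v i 0 `^ r = 1 &
    exists g : R,
      forall i, g * v i 0 `^ (r - 1) = \sum_k A i k * (A *m v) k 0 `^ (p - 1)].
Proof.
move=> n0 r1 p1 AT A0 irr D0 e1 dA hv v0.
have r0 : 0 < r := lt_trans ltr01 r1; have p0 : 0 < p := lt_trans ltr01 p1.
have nR0 : 0 < n%:R :> R by rewrite ltr0n.
pose k0 := Ordinal n0.
have Av0 : A *m v != 0.
  have [_ vmax] := is_argmax_rp_sum r0 p0 A0 v0 hv.
  have c0 : 0 < (n%:R^-1) `^ r^-1 :> R by rewrite powR_gt0 ?invr_gt0.
  apply/eqP => Av.
  have : \sum_k (A *m const_mx ((n%:R^-1) `^ r^-1) : 'cV_n) k 0 `^ p <=
      \sum_k (A *m v) k 0 `^ p.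
    apply: vmax => [i|]; first by rewrite mxE ltW.
    under eq_bigr do rewrite mxE powR_VK ?invr_ge0 ?ltW//.
    by rewrite sumr_const card_ord -[leLHS]mulr_natl divff ?gt_eqF.
  rewrite Av [leRHS]big1 => [|k _]; last by rewrite mxE powR0 ?gt_eqF.
  apply/negP; rewrite -ltNge.
  rewrite (bigD1 k0)//= ltr_pwDl ?sumr_ge0//; last by move=> k _; exact: powR_ge0.
  rewrite powR_gt0// mxE.
  have De : 0 < D * (1 - e) by rewrite mulr_gt0 ?subr_gt0.
  apply: (@lt_le_trans _ _ (D * (1 - e) * (n%:R^-1) `^ r^-1)).
    by rewrite mulr_gt0.
  by apply: row_sums_within_ge => // j; rewrite mxE.
have [sv [g g0 crit]] := argmax_critical r1 p1 A0 v0 hv Av0.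
have vpos := argmax_pos r1 p1 A0 irr v0 hv Av0.
have [i0 _ i0max] := @arg_maxP _ R _ k0 xpredT (fun i => v i 0) isT.
have [j0 _ j0min] := @arg_minP _ R _ k0 xpredT (fun i => v i 0) isT.
exists i0, j0; split => //.
  by move=> i; apply/andP; split; [exact: j0min|exact: i0max].
exists g => i; rewrite crit; apply: eq_bigr => k _.
by congr (_ * _); rewrite -[in LHS]AT mxE.
Qed.

Lemma almost_regular_within (R : realType) (n : nat) (D e : R) (A : 'M[R]_n) :
  \big[Num.max/0]_(i < n) `|row_sum A i - D| <= D * e -> row_sums_within D e A.
Proof.
move=> H i; have := le_trans (le_bigmax _ (fun i => `|row_sum A i - D|) i) H.
by rewrite ler_distl mulrBr mulrDr mulr1.
Qed.

(** The first-order term of the subcritical bound, with an explicit constant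
    for the second-order remainder. *)
Lemma powR_ratio_le (R : realType) (q e : R) : 0 <= q -> 0 < e -> e <= 8^-1 ->
  q * e <= 8^-1 ->
  ((1 + e) / (1 - e)) `^ q <= 1 + 2 * q * (e + (2 + 16 * q) * e ^+ 2).
Proof.
move=> q0 e0 e8 qe.
have w0 : 0 < 1 - e by lra.
pose y := 2 * e / (1 - e).
have -> : (1 + e) / (1 - e) = 1 + y by rewrite /y; field; rewrite gt_eqF.
have y0 : 0 <= y by rewrite divr_ge0 ?mulr_ge0 ?ltW.
have yle : y <= 2 * e + 4 * e ^+ 2 by rewrite ler_pdivrMr//; nra.
have y4 : y <= 4 * e by nra.
have qy : q * y <= q * (2 * e + 4 * e ^+ 2) by rewrite ler_wpM2l.
have qy4 : q * y <= 4 * (q * e).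
  by rewrite (_ : 4 * (q * e) = q * (4 * e)) ?ler_wpM2l//; ring.
have qy0 : 0 <= q * y by rewrite mulr_ge0.
apply: le_trans (powR1D_le q0 y0 _) _; first lra.
have : (q * y) ^+ 2 <= (4 * (q * e)) ^+ 2.
  by rewrite ler_sqr ?nnegrE// (le_trans qy0).
by lra.
Qed.

Theorem proposition5p3 (R : realType) (A : forall n : nat, 'M[R]_n)
    (eps mu : nat -> R) (p r Cs : R) (v : forall n : nat, 'cV[R]_n)
    (hsym : forall n : nat, (0 < n)%N -> (A n)^T = A n)
    (hnonneg : forall n : nat, (0 < n)%N -> forall i j : 'I_n, 0 <= A n i j)
    (hirr : forall n : nat, (0 < n)%N -> irreducible_mx ((A n)^T *m A n))
    (heps : forall n : nat, (0 < n)%N -> 0 < eps n)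
    (heps0 : eps n @[n --> \oo] --> (0 : R))
    (hmu : forall n : nat, (0 < n)%N -> 0 < mu n < 1)
    (hreg : almost_regular eps mu A)
    (hp : 1 < p) (hpr : p <= r) (hCs : 0 < Cs)
    (hv : forall n : nat, (0 < n)%N ->
       is_argmax_rp r p (A n) (v n) /\ forall i : 'I_n, 0 <= v n i 0) :
  exists n0 : nat, (1 <= n0)%N /\
    (p < r ->
       exists (delta : nat -> R) (K : R),
         (forall n : nat, (0 < n)%N -> `|delta n| <= K * eps n ^+ 2) /\
         forall n : nat, (n0 <= n)%N ->
           `|v n - const_mx (n%:R `^ (- (1 / r)))|
             <= 2 * p / (r - p) * n%:R `^ (- (1 / r)) * (eps n + delta n))
    /\
    (p = r -> well_connected Cs mu A ->
       forall n : nat, (n0 <= n)%N ->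
         `|v n - const_mx (n%:R `^ (- (1 / r)))|
           <= 10 * r / (Cs * (r - 1)) * eps n * n%:R `^ (- (1 / r))).
Proof.
have r1 : 1 < r := lt_le_trans hp hpr.
have r0 : 0 < r := lt_trans ltr01 r1.
have p0 : 0 < p := lt_trans ltr01 hp.
have b0 : 0 < r - 1 by rewrite subr_gt0.
have small c : 0 < c -> exists N : nat, forall n, (N <= n)%N -> eps n < c.
  by move=> c0; have [N _ HN] := cvgr_lt _ heps0 _ c0; exists N.
pose q := p / (r - p).
(* with the convention x / 0 = 0, q is 0 for p = r *)
have q0 : 0 <= q by rewrite divr_ge0 ?subr_ge0 ?(ltW p0).
have q8 : 0 < (8 * (q + 1))^-1 by rewrite invr_gt0 mulr_gt0// ltr_wpDl.
have [Na epsa] := small _ q8.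
have [Nb epsb] : exists N : nat, forall n, (N <= n)%N -> (0 < n)%N ->
    [/\ r * eps n <= 20^-1, 100 * (r * eps n) * (r - 1) <= Cs &
        10 * (r * eps n) <= (r - 1) * Cs].
  have [|N1 h1] := small (20 * r)^-1; first by rewrite invr_gt0 mulr_gt0.
  have [|N2 h2] := small (Cs / (100 * r * (r - 1))).
    by rewrite divr_gt0// !mulr_gt0.
  have [|N3 h3] := small ((r - 1) * Cs / (10 * r)).
    by rewrite divr_gt0// !mulr_gt0.
  exists (maxn N1 (maxn N2 N3)) => n; rewrite !geq_max => /and3P[l1 l2 l3] n0.
  split.
  - have := h1 _ l1; rewrite -[_^-1]mul1r ltr_pdivlMr ?mulr_gt0//; lra.
  - have := h2 _ l2; rewrite ltr_pdivlMr ?mulr_gt0//; lra.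
  - have := h3 _ l3; rewrite ltr_pdivlMr ?mulr_gt0//; lra.
have [Nr [Nr1 reg]] := hreg.
(* the threshold for well-connectedness must be fixed before that property
   is assumed, hence the case analysis *)
have [Nw conn] : exists N : nat, well_connected Cs mu A -> forall n : nat,
    (N <= n)%N -> forall i j : 'I_n,
      Cs * n%:R * mu n ^+ 2 <= \sum_(k < n) A n i k * A n k j.
  by have [[N [_ H]]|nwc] := pselect (well_connected Cs mu A); [exists N|exists 0%N].
have eps8 n : (Na <= n)%N -> (0 < n)%N ->
    eps n <= 8^-1 /\ q * eps n <= 8^-1.
  move=> /epsa + /heps e0; rewrite -[_^-1]mul1r ltr_pdivlMr ?mulr_gt0 ?ltr_wpDl//.
  have : 0 <= q * eps n by rewrite mulr_ge0// ltW.
  by move=> ? ?; split; lra.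
exists (maxn (maxn Na Nb) (maxn Nr Nw)); split; first by rewrite !leq_max Nr1 !orbT.
have data n : (maxn (maxn Na Nb) (maxn Nr Nw) <= n)%N ->
  [/\ (0 < n)%N, (Na <= n)%N, (Nb <= n)%N, (Nw <= n)%N &
    [/\ 0 < n%:R * mu n, 0 < eps n < 1,
      row_sums_within (n%:R * mu n) (eps n) (A n) &
    exists i0 j0 : 'I_n, [/\ 0 < v n j0 0,
      forall i, v n j0 0 <= v n i 0 <= v n i0 0,
      \sum_i v n i 0 `^ r = 1 &
      exists g : R, forall i, g * v n i 0 `^ (r - 1) =
        \sum_k A n i k * (A n *m v n) k 0 `^ (p - 1)]]].
  rewrite !geq_max -andbA => /and4P[na nb nr nw].
  have n0 : (0 < n)%N := leq_trans Nr1 nr.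
  have D0 : 0 < n%:R * mu n by rewrite mulr_gt0 ?ltr0n//; case/andP: (hmu _ n0).
  have e01 : 0 < eps n < 1 by rewrite heps//; have [] := eps8 _ na n0; lra.
  have dA := almost_regular_within (reg _ nr).
  split => //; split => //; have [am v0] := hv _ n0.
  apply: (argmax_extremal_critical n0 r1 hp (hsym _ n0) (hnonneg _ n0)
    (hirr _ n0) D0 _ dA am v0).
  by case/andP: e01.
split.
- move=> pr.
  exists (fun n => (2 + 16 * q) * eps n ^+ 2), (2 + 16 * q); split.
    by move=> n _; rewrite ger0_norm// mulr_ge0 ?sqr_ge0// addr_ge0// mulr_ge0.
  move=> n /data[n0 na _ _ [D0 e01 dA [i0 [j0 [m0 mM sv [g crit]]]]]].
  apply: (dist_const_le r1 m0 mM sv) => mnu.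
  have ratio := critical_ratio_le hp pr D0 e01 (hnonneg _ n0) dA m0 mM crit.
  case/andP: e01 => e0 e1.
  have [e8 qe] := eps8 _ na n0.
  have le_pow := powR_ratio_le q0 e0 e8 qe.
  have := ler_wpM2l (ltW m0) le_pow.
  have pos : 0 <= 2 * q * (eps n + (2 + 16 * q) * eps n ^+ 2).
    apply: mulr_ge0; first by lra.
    by apply: addr_ge0; [exact: ltW|apply: mulr_ge0; [lra|exact: sqr_ge0]].
  have := ler_wpM2r pos mnu.
  rewrite (_ : 2 * p / (r - p) = 2 * q) ?mulrA//.
  rewrite -/q in ratio.
  move: (_ `^ q) ratio => rho ratio; lra.
- move=> pr /conn wc n /data[n0 _ nb nw [D0 e01 dA [i0 [j0 [m0 mM sv [g crit]]]]]].
  rewrite pr in crit.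
  apply: (dist_const_le r1 m0 mM sv) => mnu.
  have [re reC reb] := epsb _ nb n0.
  have mu0 : 0 < mu n by case/andP: (hmu _ n0).
  have osc := critical_osc_le r1 mu0 e01 (hnonneg _ n0) dA (wc _ nw) hCs m0 mM
    crit re reC.
  case/andP: e01 => e0 e1.
  have bC0 : 0 < (r - 1) * Cs by rewrite mulr_gt0.
  have M0 : 0 < v n i0 0 by case/andP: (mM j0) => _; exact: lt_le_trans.
  (* the constant 10 is twice the 5 of critical_osc_le because M <= 2 m *)
  have M2 : v n i0 0 <= 2 * v n j0 0.
    have := ler_wpM2r (ltW M0) reb => reM.
    suff : (r - 1) * Cs * (v n i0 0 - v n j0 0) <= (r - 1) * Cs * (v n i0 0 / 2).
      by rewrite ler_pM2l//; lra.
    by lra.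
  have re0 : 0 <= r * eps n by rewrite mulr_ge0 ?ltW.
  have := ler_wpM2l re0 M2; have := ler_wpM2l re0 mnu => h1 h2.
  rewrite -(ler_pM2l bC0).
  rewrite [leRHS](_ : _ = 10 * (r * eps n * n%:R `^ (- (1 / r)))).
    by lra.
  by move: (n%:R `^ _) => nu; field; rewrite !gt_eqF.
Qed.
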